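(* Let $n,s$ be integers with $(n+2)/3\le s\le n/2$ and let $L=[s]=\{1,\ldots,s\}$. If $\mathcal{F}\subseteq 2^{[n]}$ is $L$-differencing Sperner, i.e. $|A\setminus B|\in L$ for all distinct $A,B\in\mathcal{F}$, then $$|\mathcal{F}|\le\sum_{i=3s-n-1}^{s}\binom{n-1}{i}.$$
   Context: $[n]=\{1,\ldots,n\}$ and $2^{[n]}$ is the family of all subsets of $[n]$. *)

(* Defs.v *)
From mathcomp Require Import all_boot.
Set Implicit Arguments. Unset Strict Implicit. Unset Printing Implicit Defensive.

Definition L_differencing n (L : pred nat) (F : {set {set 'I_n}}) : Prop :=
  forall A B, A \in F -> B \in F -> A != B -> L #|A :\: B|.

Definition segment (s : nat) : pred nat := fun k => (1 <= k <= s).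

(* Main.v *)
(** A bottom layer of size [k < s] may be replaced by its upper shadow: the family
remains [s]-differencing because the new sets have at most [s] elements, and it does
not shrink by double counting.  Together with complementation this moves all sizes
into [[s, n - s]].

Fix a point [i0] and work on the face [i0 \in x] of the cube, a cube in [n - 1]
variables.  There the polynomials [\prod_(1 <= l <= s) (l - #|A :\: x|)] for
[A \in F] are independent of one another and of the multiples
[x_K * \prod_(s <= k <= n - s + 1) (k - #|x|)] with [#|K| <= 3 * s - n - 2], by
evaluation at [i0 |: B] for [B \in F] and at [i0 |: K].  All of them have degree at
most [s], and comparing dimensions gives the bound. *)
Require Import Defs.
From mathcomp Require Import all_boot.
From mathcomp Require Import all_order all_algebra zify.
Set Implicit Arguments. Unset Strict Implicit. Unset Printing Implicit Defensive.

(** * Polynomial functions on the face of the cube through [i0] *)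

Section Polynomials.

Import GRing.Theory Num.Theory.
Local Open Scope ring_scope.

(** In a vanishing linear combination, choose an index of least [rk] among those with nonzero
    coefficient and evaluate at its point: every other term is zero, by its coefficient or by
    triangularity. Hence the [f i] are free. *)
Lemma card_le_dim_triangular (K : fieldType) (X I : finType) (S : {set I})
    (V : {vspace {ffun X -> K^o}}) (f : I -> {ffun X -> K^o})
    (p : I -> X) (rk : I -> nat) :
    {in S, forall i, f i \in V} ->
    {in S, forall i, f i (p i) != 0} ->
    {in S &, forall i j, (rk i <= rk j)%N -> i != j -> f j (p i) = 0} ->
  (#|S| <= \dim V)%N.
Proof.
move=> fV fpp fp0.
pose t := [tuple f (enum_val i) | i < #|S|].
have tE (j : 'I_#|S|) : t`_j = f (enum_val j) by rewrite -tnth_nth tnth_mktuple.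
have free_t : free t.
  apply/freeP => u u0; apply/eqfunP/forallP => i; apply: contraT => ui.
  case: (@arg_minnP _ i (fun k => u k != 0) (fun k => rk (enum_val k)) ui) => m um minm.
  move/ffunP/(_ (p (enum_val m))): u0; rewrite sum_ffunE ffunE (bigD1 m) //=.
  rewrite big1 ?addr0 => [|j jm].
    move/eqP; rewrite tE ffunE mulf_eq0 (negPf um) /=.
    by rewrite (negPf (fpp _ (enum_valP m))).
  rewrite tE ffunE.
  have [->|uj] := eqVneq (u j) 0; first by rewrite scale0r.
  rewrite fp0 ?scaler0 ?enum_valP ?minm //.
  by rewrite (inj_eq enum_val_inj) eq_sym.
have sub_t : (<<t>> <= V)%VS.
  by apply/span_subvP => _ /mapP[i _ ->]; apply/fV/enum_valP.
by have := dimvS sub_t; rewrite (eqP free_t) size_tuple.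
Qed.

Variables (T : finType) (i0 : T).

Implicit Types (A K x : {set T}) (d : nat).

(** The squarefree monomial [x_K], evaluated at the indicator vector of [x]. *)
Definition monomial K : {ffun {set T} -> rat^o} :=
  [ffun x : {set T} => (K \subset x)%:R].

Definition low_sets d := [set K : {set T} | (K \subset [set~ i0]) && (#|K| <= d)%N].

(* A function [g] on the face [i0 \in x] is represented by [fun x => g (i0 |: x)],
which does not depend on the coordinate [i0]. *)
Definition low_deg d : {vspace {ffun {set T} -> rat^o}} :=
  <<[seq monomial K | K <- enum (low_sets d)]>>%VS.

Lemma card_low_sets d : #|low_sets d| = (\sum_(0 <= i < d.+1) 'C(#|T| - 1, i))%N.
Proof.
have cT : #|[set~ i0]| = (#|T| - 1)%N by rewrite cardsC1 subn1.
rewrite -cT; elim: d => [|d IHd]; rewrite big_nat_recr //= -cards_draws.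
  by rewrite big_geq // add0n; apply: eq_card => K; rewrite !inE leqn0.
rewrite -IHd -cardsUI [X in (_ + #|pred_of_set X|)%N](_ : _ = set0).
  rewrite cards0 addn0; apply: eq_card => K.
  by rewrite !inE -andb_orr leq_eqVlt ltnS orbC.
apply/setP => K; rewrite !inE.
by case: eqP => [->|]; rewrite ?ltnn !andbF.
Qed.

Lemma dim_low_deg d : (\dim (low_deg d) <= \sum_(0 <= i < d.+1) 'C(#|T| - 1, i))%N.
Proof. by rewrite -card_low_sets (leq_trans (dim_span _)) // size_map -cardE. Qed.

Lemma monomial_low_deg d K : K \in low_sets d -> monomial K \in low_deg d.
Proof. by move=> Kd; apply/memv_span/map_f; rewrite mem_enum. Qed.

Lemma low_degS d : (low_deg d <= low_deg d.+1)%VS.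
Proof.
apply: sub_span => f /mapP[K]; rewrite mem_enum inE => /andP[Ki Kd] ->.
by apply: map_f; rewrite mem_enum inE Ki leqW.
Qed.

(** The coordinate [i0] is constantly 1 on the face. Any other coordinate is idempotent, so it turns
    the monomial of [K] into that of [i |: K]. *)
Lemma low_degX d i (f : {ffun {set T} -> rat^o}) : f \in low_deg d ->
  [ffun x => (i \in i0 |: x)%:R * f x] \in low_deg d.+1.
Proof.
move=> fd; have [->|ii0] := eqVneq i i0.
  apply: (subvP (low_degS d)); rewrite [X in X \in _](_ : _ = f) //.
  by apply/ffunP => x; rewrite ffunE setU11 mul1r.
pose t := in_tuple [seq monomial K | K <- enum (low_sets d)].
rewrite (coord_span (fd : f \in <<t>>%VS)); set c := coord t.
rewrite [X in X \in _](_ : _ =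
    \sum_j c j f *: [ffun x => (i \in i0 |: x)%:R * t`_j x]); last first.
  apply/ffunP => x; rewrite ffunE !sum_ffunE mulr_sumr.
  by apply: eq_bigr => j _; rewrite !ffunE; apply: mulrCA.
apply: memv_suml => j _; apply: memvZ.
have /mapP[K] := mem_nth 0 (ltn_ord j : j < size t)%N.
rewrite mem_enum inE => /andP[Ki Kd] ->.
rewrite [X in X \in _](_ : _ = monomial (i |: K)).
  apply: monomial_low_deg; rewrite inE subUset sub1set !inE ii0 Ki /=.
  by rewrite cardsU1 -add1n leq_add ?leq_b1.
apply/ffunP => x; rewrite !ffunE -natrM mulnb.
by rewrite !inE (negPf ii0) subUset sub1set.
Qed.

(** The size of [A :&: (i0 |: x)] is the sum of the coordinates indexed by [A], so each factor is
    affine and raises the degree by at most one. *)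
Lemma low_deg_prod d A (r : seq rat) (f : {ffun {set T} -> rat^o}) :
  f \in low_deg d ->
  [ffun x => \prod_(c <- r) (#|A :&: (i0 |: x)|%:R + c) * f x] \in low_deg (d + size r).
Proof.
move=> fd; elim: r => [|c r IHr] /=.
  rewrite addn0 [X in X \in _](_ : _ = f) //.
  by apply/ffunP => x; rewrite ffunE big_nil mul1r.
pose g : {ffun {set T} -> rat^o} :=
  [ffun x => \prod_(c <- r) (#|A :&: (i0 |: x)|%:R + c) * f x].
rewrite addnS [X in X \in _](_ : _ =
    \sum_(i in A) [ffun x => (i \in i0 |: x)%:R * g x] + c *: g).
  apply: memvD; last by apply/memvZ/(subvP (low_degS _)).
  by apply: memv_suml => i _; apply: low_degX.
apply/ffunP => x; rewrite !ffunE sum_ffunE big_cons -mulrA mulrDl; congr (_ + _).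
set y := _ * f x; rewrite -sum1_card natr_sum (eq_bigl (fun i => (i \in A) && (i \in i0 |: x))).
  rewrite big_mkcondr mulr_suml; apply: eq_bigr => i _; rewrite !ffunE -/y.
  by case: (i \in _).
by move=> i; rewrite inE.
Qed.

(** The factor for [l] equals [l - #|A :\: (i0 |: x)|], written through the intersection so that it
    is visibly affine. *)
Definition diff_poly s A : {ffun {set T} -> rat^o} :=
  [ffun x => \prod_(c <- [seq l%:R - #|A|%:R | l <- index_iota 1 s.+1])
               (#|A :&: (i0 |: x)|%:R + c) * monomial set0 x].

(** The intersection with [setT] makes this an instance of [low_deg_prod]. *)
Definition layer_poly a b K : {ffun {set T} -> rat^o} :=
  [ffun x => \prod_(c <- [seq - (k%:R : rat) | k <- index_iota a b])
               (#|setT :&: (i0 |: x)|%:R + c) * monomial K x].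

Lemma diff_poly_low_deg s A : diff_poly s A \in low_deg s.
Proof.
have := @low_deg_prod 0 A [seq l%:R - #|A|%:R | l <- index_iota 1 s.+1] (monomial set0).
rewrite size_map size_iota subn1; apply.
by apply: monomial_low_deg; rewrite inE sub0set cards0.
Qed.

Lemma layer_poly_low_deg d a b K :
  K \in low_sets d -> layer_poly a b K \in low_deg (d + (b - a)).
Proof.
move=> Kd.
have := @low_deg_prod d setT [seq - (k%:R : rat) | k <- index_iota a b] (monomial K).
by rewrite size_map size_iota; apply; apply: monomial_low_deg.
Qed.

Lemma diff_poly_eq0 s A x :
  (diff_poly s A x == 0) = (0 < #|A :\: (i0 |: x)| <= s)%N.
Proof.
rewrite ffunE ffunE sub0set mulr1 big_map prodf_seq_eq0 /=.
have cA := cardsID (i0 |: x) A.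
apply/hasP/idP => [[l]|ls].
  rewrite mem_index_iota => ls; rewrite addrA -natrD subr_eq0 eqr_nat; lia.
exists #|A :\: (i0 |: x)|; first by rewrite mem_index_iota.
by rewrite addrA -natrD cA subrr.
Qed.

Lemma layer_poly_eq0 a b K x :
  (layer_poly a b K x == 0) = (a <= #|i0 |: x| < b)%N || ~~ (K \subset x).
Proof.
rewrite ffunE ffunE mulf_eq0 big_map prodf_seq_eq0 setTI; congr (_ || _); last first.
  by rewrite pnatr_eq0; case: (_ \subset _).
apply/hasP/idP => [[k]|kab].
  by rewrite mem_index_iota subr_eq0 eqr_nat => kab /eqP->.
by exists #|i0 |: x|; rewrite ?mem_index_iota //= subrr.
Qed.

End Polynomials.

(** * The dimension bound for families in the middle layers *)

Lemma card_middle_differencing (n s : nat) (F : {set {set 'I_n}}) :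
  n + 2 <= 3 * s -> 2 * s <= n -> L_differencing (segment s) F ->
  {in F, forall A : {set 'I_n}, s <= #|A| <= n - s} ->
  #|F| <= \sum_(3 * s - n - 1 <= i < s.+1) 'C(n - 1, i).
Proof.
move=> ns sn dF mF; have n0 : 0 < n by lia.
(* By [ns] the truncated subtraction is exact. The layer product has [n - 2 * s + 2] factors, so [d]
   is the degree that brings the total to [s]. *)
pose i0 := Ordinal n0; pose d := 3 * s - n - 2.
have dE : 3 * s - n - 1 = d.+1 by lia.
pose S := [set z : {set 'I_n} + {set 'I_n} |
  match z with inl A => A \in F | inr K => K \in low_sets i0 d end].
pose f (z : {set 'I_n} + {set 'I_n}) :=
  match z with
  | inl A => diff_poly i0 s A
  | inr K => layer_poly i0 s (n - s + 2) K
  end.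
pose p (z : {set 'I_n} + {set 'I_n}) := match z with inl A => A | inr K => K end.
(* The sets containing [i0] come first: [A :\: (i0 |: B)] is [A :\: B] unless [A]
contains [i0] and [B] does not. *)
pose rk (z : {set 'I_n} + {set 'I_n}) :=
  match z with inl A => nat_of_bool (i0 \notin A) | inr K => #|K|.+2 end.
have cS : #|S| = #|F| + #|low_sets i0 d|.
  rewrite -!sum1_card big_sumType.
  by congr (_ + _); apply: eq_bigl => z; rewrite inE.
have := @card_le_dim_triangular rat _ _ S (low_deg i0 s) f p rk.
rewrite cS => H.
have {H} : #|F| + #|low_sets i0 d| <= \sum_(0 <= i < s.+1) 'C(n - 1, i).
  have := dim_low_deg i0 s; rewrite card_ord; apply: leq_trans.
  apply: H => [[A|K]|[A|K]|[B|K] [A|K']]; rewrite !inE /=.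
  - by move=> _; apply: diff_poly_low_deg.
  - move=> Kd; have sE : d + (n - s + 2 - s) = s by lia.
    by rewrite -[s in low_deg _ s]sE; apply: layer_poly_low_deg; rewrite inE.
  - by move=> _; rewrite diff_poly_eq0 setDUr setDv setI0 cards0.
  (* Here [i0 |: K] has at most [d.+1] elements, which is less than [s], so no layer factor
     vanishes. *)
  - case/andP=> _ Kd; rewrite layer_poly_eq0 subxx orbF cardsU1.
    by move: Kd; rewrite /d; case: (i0 \notin K) => /=; lia.
  - move=> BF AF rkBA BA; apply/eqP; rewrite diff_poly_eq0.
    have -> : A :\: (i0 |: B) = A :\: B.
      apply/setP => i; rewrite !inE; case: eqP => //= ->.
      by move: rkBA; case: (i0 \in B); case: (i0 \in A).
    by apply: dF => //; apply: contraNneq BA => ->.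
  (* Adjoining [i0] adds at most one element to [B], which is why the layers run up to
     [n - s + 1]. *)
  - move=> BF _ _ _; apply/eqP; rewrite layer_poly_eq0 cardsU1; apply/orP; left.
    by move: #|B| (mF _ BF) => b; case: (i0 \notin B) => /=; lia.
  (* This order cannot occur: the rank of [K] is at least 2, that of [A] at most 1. *)
  - by move=> _ _; case: (i0 \notin A).
  - move=> _ _; rewrite ltnS => KK' nKK'; apply/eqP; rewrite layer_poly_eq0.
    apply/orP; right; apply: contra nKK' => sub.
    by have /eqP-> : K' == K by rewrite eqEcard sub.
(* The size of [low_sets i0 d] cancels the binomials of index at most [d]. *)
rewrite card_low_sets card_ord dE (@big_cat_nat _ _ _ d.+1 0 s.+1) //=; last by lia.
by rewrite addnC leq_add2l.
Qed.

(** * Upper shadows of a uniform family *)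

Section Shadow.

Variables (T : finType) (k : nat) (G : {set {set T}}).

Definition upper_shadow :=
  [set B : {set T} | (#|B| == k.+1) && [exists A in G, A \subset B]].

Lemma upper_shadowP (B : {set T}) :
  reflect (#|B| = k.+1 /\ exists2 A, A \in G & A \subset B) (B \in upper_shadow).
Proof.
rewrite inE; apply: (iffP andP) => [[/eqP-> /exists_inP]|[-> BG]] //.
by split=> //; apply/exists_inP.
Qed.

Hypothesis cG : {in G, forall A : {set T}, #|A| = k}.

(** Count the pairs [A \subset B]: each [A] has [#|T| - k] supersets [i |: A] in the shadow, while
    each [B] has only [k.+1] subsets of size [k], and [k.+1 <= #|T| - k]. *)
Lemma card_upper_shadow : k.*2 < #|T| -> #|G| <= #|upper_shadow|.
Proof.
move=> kT.
have up (A : {set T}) : A \in G -> #|T| - k <= \sum_(B in upper_shadow) (A \subset B).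
  move=> AG; have -> : #|T| - k = #|~: A| by rewrite cardsCs setCK cG.
  have inj : {in ~: A &, injective (fun i => i |: A)}.
    move=> i j; rewrite !inE => iA jA /setP/(_ i).
    by rewrite setU11 !inE (negPf iA) orbF => /esym/eqP.
  rewrite -(card_in_imset inj) -sum1_card big_mkcond /= [leqRHS]big_mkcond /=.
  apply: leq_sum => B _; case: ifP => // /imsetP[i]; rewrite inE => iA ->.
  rewrite subsetUr; case: ifP => // /negP[]; apply/upper_shadowP.
  by rewrite cardsU1 iA cG //; split=> //; exists A; rewrite ?subsetUr.
have down (B : {set T}) : B \in upper_shadow -> \sum_(A in G) (A \subset B) <= k.+1.
  case/upper_shadowP=> cB _.
  have := cards_draws B k; rewrite cB binSn => <-.
  rewrite -sum1_card big_mkcond /= [leqRHS]big_mkcond /=.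
  apply: leq_sum => A _; case: ifP => // AG.
  by rewrite inE cG // eqxx andbT; case: (_ \subset _).
have kT' : k.+1 <= #|T| - k by lia.
have : \sum_(A in G) (#|T| - k) <= \sum_(B in upper_shadow) k.+1.
  apply: leq_trans (_ : \sum_(A in G) \sum_(B in upper_shadow) (A \subset B) <= _).
    exact: leq_sum up.
  by rewrite exchange_big /=; apply: leq_sum down.
rewrite !sum_nat_const => GU.
rewrite -(@leq_pmul2r (#|T| - k)) ?(leq_trans _ kT') //.
by rewrite (leq_trans GU) // leq_mul2l kT' orbT.
Qed.

End Shadow.

(** * Moving all sizes into the middle layers *)

Section Compression.

Variables (n s : nat).
Hypothesis sn : 2 * s <= n.

Implicit Types (F : {set {set 'I_n}}) (A B : {set 'I_n}).

Lemma differencing_antichain F A B : L_differencing (segment s) F ->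
  A \in F -> B \in F -> A \subset B -> A = B.
Proof.
move=> dF AF BF sAB; apply/eqP; apply: contraT => /(dF _ _ AF BF).
by move: sAB; rewrite -setD_eq0 => /eqP->; rewrite cards0.
Qed.

(** The cap [m] is carried along so that a second round of raising, after complementation, preserves
    the upper bound won by the first. *)
Lemma raise_bottom_layer k m F : k < s -> s <= m -> L_differencing (segment s) F ->
  {in F, forall A, k <= #|A| <= m} ->
  exists F', [/\ #|F| <= #|F'|, L_differencing (segment s) F' &
                {in F', forall A, k < #|A| <= m}].
Proof.
move=> ks sm dF mF.
pose G := [set A in F | #|A| == k]; pose U := upper_shadow k G.
have GF A : A \in G -> A \in F by rewrite inE => /andP[].
have FG A : A \in F :\: G -> A \in F /\ k < #|A|.
  rewrite !inE negb_and andbC => /andP[AF]; rewrite AF /= => kA.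
  by rewrite ltn_neqAle eq_sym kA; case/andP: (mF _ AF).
have cG : {in G, forall A, #|A| = k} by move=> A; rewrite inE => /andP[_ /eqP].
have above A B : A \in G -> B \in F :\: G -> ~~ (A \subset B).
  move=> AG BFG; have [BF kB] := FG _ BFG; apply/negP => sAB.
  by move: kB; rewrite -(differencing_antichain dF (GF _ AG) BF sAB) cG ?ltnn.
exists ((F :\: G) :|: U); split.
(* A set of [F :\: G] in the shadow would contain a member of [G], against the antichain
   property. *)
- rewrite cardsU (_ : _ :&: U = set0).
    rewrite cards0 subn0 -(cardsID G F) addnC leq_add2l.
    rewrite (leq_trans (subset_leq_card (subsetIr F G))) //.
    by apply: card_upper_shadow; rewrite // card_ord; lia.
  apply/setP => B; rewrite in_set0 in_setI; apply/negP => /andP[BFG].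
  by case/upper_shadowP=> _ [A AG sAB]; move: (above _ _ AG BFG); rewrite sAB.
- move=> A B AF' BF' nAB.
  suff /andP[sAB dAB] : ~~ (A \subset B) && (#|A :\: B| <= s).
    by rewrite /segment dAB andbT card_gt0 setD_eq0.
  have [/FG[AF kA]|] := setUP AF'; have [BFG|] := setUP BF'.
  + have [BF _] := FG _ BFG.
    have /andP[] := dF _ _ AF BF nAB.
    by rewrite card_gt0 setD_eq0 => -> ->.
  (* For an old [A] and a new [B] over [B0], [A] is at least as large as [B], and [A :\: B] lies
     inside [A :\: B0]. *)
  + case/upper_shadowP=> cB [B0 B0G sB0B]; apply/andP; split.
      by apply: contra nAB => sAB; rewrite eqEcard sAB cB.
    have nAB0 : A != B0 by apply: contraTneq kA => ->; rewrite cG ?ltnn.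
    have /andP[_] := dF _ _ AF (GF _ B0G) nAB0.
    by apply: leq_trans; apply/subset_leq_card/setDS.
  + case/upper_shadowP=> cA [A0 A0G sA0A]; apply/andP; split.
      by apply: contra (subset_trans sA0A) (above _ _ A0G BFG).
    by rewrite (leq_trans (subset_leq_card (subsetDl A B))) ?cA.
  + case/upper_shadowP=> cB _ /upper_shadowP[cA _]; apply/andP; split.
      by apply: contra nAB => sAB; rewrite eqEcard sAB cB cA leqnn.
    by rewrite (leq_trans (subset_leq_card (subsetDl A B))) ?cA.
- move=> A /setUP[/FG[AF ->]|/upper_shadowP[-> _]] /=.
    by case/andP: (mF _ AF).
  by rewrite ltnS leqnn (leq_trans ks).
Qed.

Lemma raise_to_layer m F : s <= m -> L_differencing (segment s) F ->
  {in F, forall A, #|A| <= m} ->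
  exists F', [/\ #|F| <= #|F'|, L_differencing (segment s) F' &
                {in F', forall A, s <= #|A| <= m}].
Proof.
move=> sm dF mF.
suff H k : k <= s -> exists F', [/\ #|F| <= #|F'|, L_differencing (segment s) F' &
    {in F', forall A, k <= #|A| <= m}] by exact: H.
elim: k => [_|k IHk ks]; first by exists F.
have [F1 [c1 d1 m1]] := IHk (ltnW ks).
have [F2 [c2 d2 m2]] := raise_bottom_layer ks sm d1 m1.
by exists F2; split=> //; apply: leq_trans c2.
Qed.

(** Complementation exchanges the two differences of a pair, and the hypothesis is symmetric in the
    pair. *)
Lemma differencing_setC F : L_differencing (segment s) F ->
  L_differencing (segment s) ((@setC _) @: F).
Proof.
move=> dF _ _ /imsetP[A AF ->] /imsetP[B BF ->]; rewrite (inj_eq (@setC_inj _)) => nAB.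
by rewrite setDE setCK setIC -setDE; apply: dF; rewrite // eq_sym.
Qed.

Lemma compress_to_middle F : L_differencing (segment s) F ->
  exists F', [/\ #|F| <= #|F'|, L_differencing (segment s) F' &
                {in F', forall A, s <= #|A| <= n - s}].
Proof.
move=> dF.
have cC A : #|~: A| = n - #|A| by rewrite cardsCs setCK card_ord.
have le_n A : #|A| <= n by rewrite -[n in leqRHS]card_ord max_card.
have sn' : s <= n by lia.
have [F1 [c1 d1 m1]] := raise_to_layer sn' dF (fun A _ => le_n A).
have m1' : {in (@setC _) @: F1, forall A, #|A| <= n - s}.
  by move=> _ /imsetP[A /m1 mA ->]; rewrite cC; lia.
have snn : s <= n - s by lia.
have [F2 [c2 d2 m2]] := raise_to_layer snn (differencing_setC d1) m1'.
(* The range from [s] to [n - s] is symmetric and only the cardinality is compared, so [F2] is not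
   complemented back. *)
by exists F2; split=> //; rewrite (leq_trans c1) // -(card_imset _ (@setC_inj _)).
Qed.

End Compression.

Theorem mainTheorem5 (n s : nat) (F : {set {set 'I_n}}) :
  n + 2 <= 3 * s -> 2 * s <= n ->
  L_differencing (segment s) F ->
  #|F| <= \sum_(3 * s - n - 1 <= i < s.+1) 'C(n - 1, i).
Proof.
move=> ns sn dF.
have [F' [cF' dF' mF']] := compress_to_middle sn dF.
exact: leq_trans cF' (card_middle_differencing ns sn dF' mF').
Qed.
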